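(* Let $(\mathcal A_n)_{n\ge 1}$ be a sequence of cones with $\mathcal A_n \subseteq \mathcal S_n$ for every $n$, such that: 1. $\mathcal A_n \subseteq \mathcal C_n$ for all $n$; 2. the matrix $\Lambda=\begin{pmatrix} 1 & -1 \\ -1 & 1 \end{pmatrix}$ belongs to $\mathcal A_2$; 3. the sequence $(\mathcal A_n)_{n \ge 1}$ has the product property. Then $\mathcal A_n \subseteq \mathcal P_n$ for all $n$.
   Context: Notation: $\mathcal S_n$ is the set of real symmetric $n\times n$ matrices; $\mathcal P_n\subseteq \mathcal S_n$ is the cone of positive semidefinite matrices; $\mathcal C_n\subseteq\mathcal S_n$ is the cone of copositive matrices, i.e. all $Q\in\mathcal S_n$ with $x^TQx\ge 0$ for every entrywise nonnegative $x\in\mathbb R^n$; $J_n$ is the $n\times n$ all-ones matrix. A cone in $\mathcal S_n$ is a subset closed under multiplication by positive real scalars (convexity or closedness is not required). For $Q\in\mathcal S_n$ and $R\in\mathcal S_m$ define the $nm\times nm$ symmetric matrix $$Q\odot R=(Q+J_n)\otimes(R+J_m)-J_{nm},$$ where $\otimes$ is the Kronecker product: indexing rows by pairs $(i,j)$ and columns by pairs $(k,l)$ in lexicographic order, $(M\otimes N)_{(i,j)(k,l)}=M_{ik}N_{jl}$. A sequence of cones $\mathcal A_n\subseteq\mathcal S_n$ ($n\ge1$) has the product property if for all $n,m$ and all $Q\in\mathcal A_n$, $R\in\mathcal A_m$, one has $Q\odot R\in\mathcal A_{nm}$. *)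

(* Defs.v *)
From mathcomp Require Import all_boot all_order all_algebra.
From mathcomp Require Import classical_sets reals mxtens.
Set Implicit Arguments.
Unset Strict Implicit.
Unset Printing Implicit Defensive.
Import Order.TTheory GRing.Theory Num.Theory.
Local Open Scope classical_set_scope.
Local Open Scope ring_scope.

Section Cones.
Variables (R : realType) (n : nat).

Definition symmetric_set : set 'M[R]_n := [set Q | Q \is symmetricmx].

Definition quadform (Q : 'M[R]_n) (x : 'cV[R]_n) : R := (x^T *m Q *m x) 0 0.

Definition psd_cone : set 'M[R]_n :=
  symmetric_set `&` [set Q | forall x : 'cV[R]_n, 0 <= quadform Q x].

Definition copositive_cone : set 'M[R]_n :=
  symmetric_set `&`
  [set Q | forall x : 'cV[R]_n, (forall i, 0 <= x i 0) -> 0 <= quadform Q x].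

(* Cones need not contain 0, nor be nonempty, convex or closed. *)
Definition is_cone (C : set 'M[R]_n) : Prop :=
  C `<=` symmetric_set /\ forall (a : R) (Q : 'M[R]_n), 0 < a -> C Q -> C (a *: Q).

End Cones.

Definition allones {R : realType} (n : nat) : 'M[R]_n := const_mx 1.

(* [*t] is the Kronecker product; the pair (i, j) has index i * m + j. *)
Definition odot {R : realType} (n m : nat) (Q : 'M[R]_n) (S : 'M[R]_m) :
    'M[R]_(n * m) :=
  (Q + allones n) *t (S + allones m) - allones (n * m).

Definition Lambda (R : realType) : 'M[R]_2 :=
  \matrix_(i, j) (if i == j then 1 else - 1).

(* The sequence starts at index 1; the value [A 0] is junk. *)
Definition product_property (R : realType) (A : forall n, set 'M[R]_n) : Prop :=
  forall n m : nat, (0 < n)%N -> (0 < m)%N ->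
  forall (Q : 'M[R]_n) (S : 'M[R]_m), A n Q -> A m S -> A (n * m)%N (odot Q S).

(* Main.v *)
Require Import Defs.
From mathcomp Require Import all_boot all_order all_algebra.
From mathcomp Require Import classical_sets reals.
From mathcomp Require Import mxtens ring lra.
Import Order.TTheory GRing.Theory Num.Theory.
Local Open Scope classical_set_scope.
Local Open Scope ring_scope.

(** Fix [Q] in [A n] and a vector [x] of arbitrary signs; write [q x] for the
    value of the quadratic form of [Q], [J] for the all-ones matrix, and [J x]
    for the value of its form.  Copositivity of [Q] alone does not give
    [q x >= 0] when the signs in [x] are mixed, but the matrices
    [odot (b *: Q) (a *: Lambda)] with [a], [b] > 0 are also in the sequence,
    hence copositive, and one of the nonnegative vectors on which they can be
    tested encodes [x].

    With [s] = (1, 1) and [d] = (1, -1), the blocks of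
    [y = |x| (x) s + x (x) d] are [|x| + x] and [|x| - x], so [y] is
    nonnegative.  Both [J] and [Lambda] are diagonal in the orthogonal basis
    [s], [d] of the plane, so the quadratic form of [odot Q (a *: Lambda)] at
    [y] splits into a part in [|x|] and a part in [x]; the matrix subtracted in
    [odot] exactly cancels [J] in the former, and the value is
    [4 (q |x| + a (q x + J x))] ([quadform_odot_Lambda]).

    As [a] is arbitrarily large, [q x + J x >= 0].  Applied to [b *: Q] this
    reads [b * q x + J x >= 0] for every [b > 0], so [q x >= 0] as well: only
    the slope of an affine function bounded below on the positive half-line
    matters ([slope_ge0]). *)

Lemma slope_ge0 (R : realFieldType) (c t : R) :
  (forall a, 0 < a -> 0 <= c + a * t) -> 0 <= t.
Proof.
move=> line_ge0; rewrite leNgt; apply/negP => t_lt0.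
(* If [t < 0], the value at this point is [c - (|c| + 1)], which is negative. *)
have a_gt0 : 0 < (`|c| + 1) / - t by rewrite divr_gt0 ?oppr_gt0 // ltr_wpDl.
have := line_ge0 _ a_gt0; rewrite invrN mulrN mulNr divfK ?lt_eqF //.
have := ler_norm c; lra.
Qed.

Definition ones2 {R : realType} : 'cV[R]_2 := const_mx 1.

Definition alt2 {R : realType} : 'cV[R]_2 := \col_i (-1) ^+ i.

Lemma allones2_ones2 (R : realType) : allones 2 *m ones2 = 2 *: ones2 :> 'cV[R]_2.
Proof. by apply/matrixP => i j; rewrite !mxE !big_ord_recl big_ord0 !mxE; ring. Qed.

Lemma allones2_alt2 (R : realType) : allones 2 *m alt2 = 0 :> 'cV[R]_2.
Proof.
by apply/matrixP => i j; rewrite !mxE !big_ord_recl big_ord0 !mxE /=; ring.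
Qed.

Lemma Lambda_ones2 (R : realType) : Lambda R *m ones2 = 0.
Proof.
apply/matrixP => i j; rewrite !mxE !big_ord_recl big_ord0 !mxE.
by case: i => [[|[|//]] ?] /=; ring.
Qed.

Lemma Lambda_alt2 (R : realType) : Lambda R *m alt2 = 2 *: alt2.
Proof.
apply/matrixP => i j; rewrite !mxE !big_ord_recl big_ord0 !mxE.
by case: i => [[|[|//]] ?] /=; ring.
Qed.

Lemma dot_ones2_ones2 (R : realType) : (ones2^T *m ones2) 0 0 = 2 :> R.
Proof. by rewrite !mxE !big_ord_recl big_ord0 !mxE /=; ring. Qed.

Lemma dot_alt2_alt2 (R : realType) : (alt2^T *m alt2) 0 0 = 2 :> R.
Proof. by rewrite !mxE !big_ord_recl big_ord0 !mxE /=; ring. Qed.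

Lemma dot_ones2_alt2 (R : realType) : (ones2^T *m alt2) 0 0 = 0 :> R.
Proof. by rewrite !mxE !big_ord_recl big_ord0 !mxE /=; ring. Qed.

Lemma dot_alt2_ones2 (R : realType) : (alt2^T *m ones2) 0 0 = 0 :> R.
Proof. by rewrite !mxE !big_ord_recl big_ord0 !mxE /=; ring. Qed.

Lemma quadformD (R : realType) (n : nat) (P Q : 'M[R]_n) (x : 'cV[R]_n) :
  quadform (P + Q) x = quadform P x + quadform Q x.
Proof. by rewrite /quadform mulmxDr mulmxDl mxE. Qed.

Lemma quadformN (R : realType) (n : nat) (Q : 'M[R]_n) (x : 'cV[R]_n) :
  quadform (- Q) x = - quadform Q x.
Proof. by rewrite /quadform mulmxN mulNmx mxE. Qed.

Lemma quadformZ (R : realType) (n : nat) (a : R) (Q : 'M[R]_n) (x : 'cV[R]_n) :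
  quadform (a *: Q) x = a * quadform Q x.
Proof. by rewrite /quadform -scalemxAr -scalemxAl mxE. Qed.

Lemma quadform_addv (R : realType) (n : nat) (Q : 'M[R]_n) (x y : 'cV[R]_n) :
  quadform Q (x + y) = quadform Q x + quadform Q y +
    ((x^T *m Q *m y) 0 0 + (y^T *m Q *m x) 0 0).
Proof.
by rewrite /quadform [(x + y)^T]linearD /= !mulmxDl !mulmxDr; rewrite !mxE; ring.
Qed.

Lemma allones_tens (R : realType) (n m : nat) :
  allones (n * m) = allones n *t allones m :> 'M[R]_(n * m).
Proof. by apply/matrixP => i j; rewrite !mxE mulr1. Qed.

(** With [p] at least [|x|] entrywise, this doubles a vector of arbitrary signs
    into a nonnegative one: the entries over index [i] are [p i + x i] and
    [p i - x i]. *)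
Definition fold_vec {R : realType} {n : nat} (p x : 'cV[R]_n) : 'cV[R]_(n * 2) :=
  (p *t ones2 : 'cV_(n * 2)) + x *t alt2.

Lemma fold_vec_ge0 (R : realType) (n : nat) (p x : 'cV[R]_n) :
  (forall i, `|x i 0| <= p i 0) -> forall k, 0 <= fold_vec p x k 0.
Proof.
move=> le_xp k; rewrite !mxE !ord1 mulr1 -lerBlDr sub0r.
apply: le_trans (ler_norm _) (le_trans _ (le_xp _)).
by rewrite normrN normrM normrX normrN1 expr1n mulr1.
Qed.

(** The mixed-product rule for columns; the casts to ['cV_(n * m)] identify the
    width [1 * 1] of a product of columns with [1]. *)
Lemma bilin_tens (R : realType) (n m : nat) (S : 'M[R]_n) (B : 'M[R]_m)
    (u p : 'cV[R]_n) (v q : 'cV[R]_m) :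
  (((u *t v : 'cV_(n * m))^T *m (S *t B) *m (p *t q : 'cV_(n * m))) 0 0) =
    (u^T *m S *m p) 0 0 * (v^T *m (B *m q)) 0 0.
Proof.
rewrite (_ : (u *t v)^T = u^T *t v^T :> 'rV_(n * m)); last first.
  by apply/matrixP => i j; rewrite !mxE.
have -> : (u^T *t v^T : 'rV_(n * m)) *m (S *t B) = (u^T *m S) *t (v^T *m B).
  exact: (@tensmx_mul R 1 n 1 m).
have -> : ((u^T *m S) *t (v^T *m B) : 'rV_(n * m)) *m (p *t q : 'cV_(n * m)) =
          (u^T *m S *m p) *t (v^T *m B *m q).
  exact: (@tensmx_mul R 1 n 1 m 1 1).
by rewrite mxE !ord1 mulmxA.
Qed.

(** The mixed terms vanish because [s] and [d] are orthogonal eigenvectors of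
    [B], where [s] and [d] stand for [ones2] and [alt2]; the factors 2 are
    their squared norms. *)
Lemma quadform_tens_fold (R : realType) (n : nat) (S : 'M[R]_n) (B : 'M[R]_2)
    (beta delta : R) (p x : 'cV[R]_n) :
    B *m ones2 = beta *: ones2 -> B *m alt2 = delta *: alt2 ->
  quadform (S *t B) (fold_vec p x) =
    2 * beta * quadform S p + 2 * delta * quadform S x.
Proof.
move=> Bs Bd; rewrite quadform_addv {1 2}/quadform !bilin_tens Bs Bd -!scalemxAr.
rewrite -/(quadform S p) -/(quadform S x).
have entryZ (c : R) (M : 'M[R]_1) : (c *: M) 0 0 = c * M 0 0 by rewrite mxE.
rewrite !entryZ dot_ones2_ones2 dot_alt2_alt2 dot_ones2_alt2 dot_alt2_ones2; ring.
Qed.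

(** On the span of [ones2] the matrices [allones 2 + a *: Lambda] and [allones 2]
    agree, with eigenvalue 2, so the subtraction in [odot] leaves [Q] there; on
    the span of [alt2] their eigenvalues are [2 * a] and 0, so that part keeps
    [Q + allones n]. *)
Lemma quadform_odot_Lambda (R : realType) (n : nat) (a : R) (Q : 'M[R]_n)
    (p x : 'cV[R]_n) :
  quadform (odot Q (a *: Lambda R)) (fold_vec p x) =
    4 * (quadform Q p + a * (quadform Q x + quadform (allones n) x)).
Proof.
rewrite /odot allones_tens quadformD quadformN.
rewrite (@quadform_tens_fold _ _ _ _ 2 (a * 2)).
- rewrite (@quadform_tens_fold _ _ _ _ 2 0) ?allones2_ones2 //.
    by rewrite !quadformD; ring.
  by rewrite allones2_alt2 scale0r.
- by rewrite mulmxDl -scalemxAl Lambda_ones2 scaler0 add0r allones2_ones2.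
- by rewrite mulmxDl -scalemxAl Lambda_alt2 allones2_alt2 addr0 scalerA.
Qed.

Theorem theorem4 (R : realType) (A : forall n : nat, set 'M[R]_n)
    (A_cone : forall n : nat, (0 < n)%N -> is_cone (A n))
    (A_copositive : forall n : nat, (0 < n)%N -> A n `<=` @copositive_cone R n)
    (A_Lambda : A 2%N (Lambda R))
    (A_product : product_property A) :
  forall n : nat, (0 < n)%N -> A n `<=` @psd_cone R n.
Proof.
move=> n n_gt0 Q AQ; have [A_sym A_scale] := A_cone n n_gt0.
split=> [|x]; first exact: A_sym.
pose p : 'cV[R]_n := \col_i `|x i 0|.
apply: (@slope_ge0 _ (quadform (allones n) x)) => b b_gt0.
apply: (@slope_ge0 _ (quadform (b *: Q) p)) => a a_gt0.
have AbQ : A n (b *: Q) by apply: A_scale.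
have AaL : A 2 (a *: Lambda R) by apply: (A_cone 2 isT).2.
have n2_gt0 : (0 < n * 2)%N by rewrite muln_gt0 n_gt0.
have [_ cop] := A_copositive _ n2_gt0 _ (A_product _ 2%N n_gt0 isT _ _ AbQ AaL).
have /cop : forall k, 0 <= fold_vec p x k 0.
  by apply: fold_vec_ge0 => i; rewrite mxE.
by rewrite quadform_odot_Lambda pmulr_rge0 // quadformZ [_ + b * _]addrC quadformZ.
Qed.
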